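(* Let $\ell_1,\ell_2\in\mathbb{N}\setminus\{1\}$ satisfy $\gcd(\ell_1,\ell_2)=1$, and let $p(x,y):=x^{\ell_1}-y^{\ell_2}$. Define $$f(x,y):=\begin{cases}x, & \text{if }\ell_1\text{ is odd and }\ell_2\text{ is even},\\ y, & \text{if }\ell_1\text{ is even and }\ell_2\text{ is odd},\\ xy, & \text{if }\ell_1\text{ and }\ell_2\text{ are both odd}.\end{cases}$$ Then $f$ is nonnegative on $\mathcal{Z}_p$, but $f\notin\Sigma_{\{1,p,-p\},n}$ for every $n\in\mathbb{N}$. Equivalently, the class of $f$ is not a sum of squares in the coordinate ring $\mathbb{R}[x,y]/(p)$.
   Context: Here $\mathbb{N}=\{1,2,\ldots\}$ and $\mathcal{Z}_p=\{(x,y)\in\mathbb{R}^2:p(x,y)=0\}$. For $Q=\{q_0:=1,q_1,\ldots,q_m\}\subset\mathbb{R}[x,y]$, the $n$-th truncated quadratic module generated by $Q$ is $$\Sigma_{Q,n}:=\left\{\sum_{i=0}^m\sum_{j=1}^{N_i}q_if_{ij}^2:\ N_i\in\mathbb{N}\cup\{0\},\ f_{ij}\in\mathbb{R}[x,y],\ \deg(q_if_{ij}^2)\le 2n\right\}.$$ *)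

(* Defs.v *)
From HB Require Import structures.
From mathcomp Require Import all_boot all_order all_algebra.
From mathcomp Require Import ring_quotient.
From mathcomp Require Import boolp classical_sets reals.
From mathcomp Require Import mpoly.

Set Implicit Arguments.
Unset Strict Implicit.
Unset Printing Implicit Defensive.

Import Order.TTheory GRing.Theory Num.Theory.
Local Open Scope ring_scope.
Local Open Scope classical_set_scope.

(* R[x,y] is {mpoly R[2]} with x = 'X_0 and y = 'X_1; the plane R^2 is
   'I_2 -> R. *)

Definition zero_locus (R : realType) (p : {mpoly R[2]}) : set ('I_2 -> R) :=
  [set v | p.@[v] = 0].

(* Q lists all the generators q_0, ..., q_m, including q_0 = 1.  Since msize
   is the total degree plus one (and 0 on the zero polynomial),
   msize g <= (2 * n).+1 says deg g <= 2n, with deg 0 = -oo. *)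
Definition trunc_quad_module (R : realType) (Q : seq {mpoly R[2]}) (n : nat) :
    set {mpoly R[2]} :=
  [set g | exists F : 'I_(size Q) -> seq {mpoly R[2]},
     (forall i f, f \in F i -> (msize (Q`_i * f ^+ 2) <= (2 * n).+1)%N) /\
     g = \sum_(i < size Q) \sum_(f <- F i) Q`_i * f ^+ 2].

Definition sum_of_squares (A : nzRingType) (a : A) : Prop :=
  exists s : seq A, a = \sum_(b <- s) b ^+ 2.

Definition nonunit (A : comNzRingType) (a : A) : Prop :=
  ~ exists h : A, h * a = 1.

(* The library only forms ring quotients by proper ideals, hence the
   (computationally irrelevant) argument showing that a is not a unit. *)
Definition principal_ideal (A : comNzRingType) (a : A) (_ : nonunit a) :
    {pred A} :=
  fun g => `[< exists h : A, g = h * a >].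

Section PrincipalIdeal.
Variables (A : comNzRingType) (a : A) (ha : nonunit a).

Lemma principal_idealP (g : A) :
  reflect (exists h : A, g = h * a) (g \in principal_ideal ha).
Proof. exact: asboolP. Qed.

Lemma principal_ideal_closed : idealr_closed (principal_ideal ha).
Proof.
split.
- by apply/principal_idealP; exists 0; rewrite mul0r.
- by apply/principal_idealP => -[h eh]; apply: ha; exists h.
- move=> b u v /principal_idealP[h ->] /principal_idealP[k ->].
  by apply/principal_idealP; exists (b * h + k); rewrite mulrDl mulrA.
Qed.

HB.instance Definition _ :=
  isIdealr.Build A (principal_ideal ha) principal_ideal_closed.

End PrincipalIdeal.

Notation coordinate_ring hp := {ideal_quot (principal_ideal hp)}.

Definition curve_poly (R : realType) (l1 l2 : nat) : {mpoly R[2]} :=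
  'X_0 ^+ l1 - 'X_1 ^+ l2.

Lemma curve_poly_nonunit (R : realType) (l1 l2 : nat) :
  (1 < l1)%N -> (1 < l2)%N -> nonunit (curve_poly R l1 l2).
Proof.
move=> h1 h2 [h /(congr1 (meval (fun=> 0)))].
rewrite mevalM mevalB !rmorphXn /= !mevalXU !expr0n.
rewrite !gtn_eqF ?(ltnW h1) ?(ltnW h2) //= subrr mulr0 meval1.
by move/eqP; rewrite eq_sym oner_eq0.
Qed.

Arguments curve_poly_nonunit R {l1 l2}.

(* The last branch stands for "both odd": the remaining parity pattern, both
   even, is excluded when l1 and l2 are coprime. *)
Definition parity_poly (R : realType) (l1 l2 : nat) : {mpoly R[2]} :=
  if odd l1 && ~~ odd l2 then 'X_0
  else if ~~ odd l1 && odd l2 then 'X_1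
  else 'X_0 * 'X_1.

(* Main.v *)
From HB Require Import structures.
Require Import Defs.
From mathcomp Require Import all_boot all_order all_algebra.
From mathcomp Require Import ring_quotient.
From mathcomp Require Import boolp classical_sets reals.
From mathcomp Require Import mpoly.
From mathcomp Require Import zify.

Set Implicit Arguments.
Unset Strict Implicit.
Unset Printing Implicit Defensive.

Import Order.TTheory GRing.Theory Num.Theory.
Local Open Scope ring_scope.
Local Open Scope classical_set_scope.
Local Open Scope quotient_scope.

(** The curve x^l1 = y^l2 is parametrised by t |-> (t^l2, t^l1), so substitution
    is a ring morphism from R[x,y] to R[t] that kills p ([cusp_pullback]), and
    its image only contains polynomials whose exponents lie in the numerical
    semigroup generated by l1 and l2 ([cusp_pullback_supp]).  In all the parity
    cases f is x^a y^b with a, b the residues of l1, l2 modulo 2, so f pulls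
    back to t^(a l2 + b l1).  This exponent is even, say 2m: f looks like the
    square of t^m.  However m is a gap of the semigroup
    ([half_exponent_gap]), and this is the obstruction.

    Indeed, if f were a sum of squares modulo p, then t^(2m) would be a sum of
    squares of pullbacks.  Over an ordered ring leading terms of squares cannot
    cancel, so the polynomials being squared have degree at most m, and the
    coefficient of t^(2m) is the sum of the squares of the m-th coefficients
    ([sum_sqr_eq_monomial]).  One of these is nonzero, which puts m in the
    semigroup, a contradiction.

    Membership in a truncated quadratic module and being a sum of squares in
    the coordinate ring both yield an identity f = (sum of squares) + h p, so
    [parity_poly_not_sos_mod] refutes both, and their equivalence holds because
    both negations are true.  Nonnegativity of f on the curve is a matter of
    signs of even and odd powers. *)

Lemma coef_sqr_top (R : nzRingType) (g : {poly R}) (N : nat) :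
  (size g <= N.+1)%N -> (g ^+ 2)`_(N + N) = g`_N ^+ 2.
Proof.
move=> sg; have ltN : (N < (N + N).+1)%N by rewrite ltnS leq_addr.
rewrite expr2 coefM (bigD1 (Ordinal ltN)) //= addnK -expr2 big1 ?addr0 // => i.
rewrite -val_eqE /= neq_ltn => /orP[lti | gti].
  by rewrite [X in _ * X]nth_default ?mulr0 // (leq_trans sg) //; lia.
by rewrite nth_default ?mul0r // (leq_trans sg).
Qed.

(** Leading coefficients enter a sum of squares through their squares, which
    cannot cancel; so a bound on the degrees of the polynomials g can be
    lowered one step at a time, down to half the degree of the sum. *)
Lemma size_sum_sqr (R : realDomainType) (s : seq {poly R}) (m : nat) :
  (size (\sum_(g <- s) g ^+ 2)%R <= (m + m).+1)%N ->
  forall g, g \in s -> (size g <= m.+1)%N.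
Proof.
move=> ss.
suff bound k : (forall g, g \in s -> (size g <= m.+1 + k)%N) ->
    forall g, g \in s -> (size g <= m.+1)%N.
  apply: (bound (\max_(g <- s) size g)%N) => g gs.
  by apply: leq_trans (leq_addl _ _); exact: leq_bigmax_seq.
elim: k => [|k IHk] sk g gs; first by rewrite -[m.+1]addn0 sk.
apply: IHk => // {}g {}gs.
have /eqP : \sum_(g <- s) g`_(m + k.+1) ^+ 2 = 0.
  transitivity (\sum_(g <- s) g ^+ 2)`_((m + k.+1) + (m + k.+1)); last first.
    by rewrite nth_default // (leq_trans ss) //; lia.
  rewrite coef_sum big_seq [RHS]big_seq; apply: eq_bigr => h hs.
  by rewrite coef_sqr_top // -addSn sk.
rewrite psumr_eq0 => [|h _]; last exact: sqr_ge0.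
move=> /allP/(_ g gs); rewrite sqrf_eq0 => /eqP gk0.
apply/leq_sizeP => j; rewrite leq_eqVlt => /predU1P[<-|ltj].
  by rewrite addSnnS.
by move/leq_sizeP: (sk g gs); apply; rewrite addnS.
Qed.

Lemma sum_sqr_eq_monomial (R : realDomainType) (s : seq {poly R}) (m : nat) :
  \sum_(g <- s) g ^+ 2 = 'X^(m + m) -> exists2 g, g \in s & g`_m != 0.
Proof.
move=> es; have sz : (size (\sum_(g <- s) g ^+ 2)%R <= (m + m).+1)%N.
  by rewrite es size_polyXn.
apply: contrapT => nex; have /eqP := congr1 (fun g : {poly R} => g`_(m + m)) es.
rewrite coefXn eqxx coef_sum big_seq big1 => [|g gs].
  by rewrite eq_sym oner_eq0.
rewrite coef_sqr_top ?(size_sum_sqr sz) //.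
by apply/eqP; rewrite sqrf_eq0; apply: contrapT => /negP g0; apply: nex; exists g.
Qed.

Section Parametrisation.
Variables (R : realType) (l1 l2 : nat).

Definition cusp_param (i : 'I_2) : {poly R} :=
  if i == 0 then 'X^l2 else 'X^l1.

Definition cusp_pullback : {mpoly R[2]} -> {poly R} := mmap polyC cusp_param.

HB.instance Definition _ := GRing.RMorphism.on cusp_pullback.

Lemma cusp_pullback_X0 : cusp_pullback 'X_0 = 'X^l2.
Proof. by rewrite /cusp_pullback mmapX mmap1U. Qed.

Lemma cusp_pullback_X1 : cusp_pullback 'X_1 = 'X^l1.
Proof. by rewrite /cusp_pullback mmapX mmap1U. Qed.

Lemma cusp_pullback_curve : cusp_pullback (curve_poly R l1 l2) = 0.
Proof.
rewrite rmorphB !rmorphXn /= cusp_pullback_X0 cusp_pullback_X1.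
by rewrite -!exprM mulnC subrr.
Qed.

Lemma cusp_pullback_supp (q : {mpoly R[2]}) (k : nat) :
  (cusp_pullback q)`_k != 0 -> exists i j, (i * l2 + j * l1)%N = k.
Proof.
move=> qk; apply: contrapT => nex; move/eqP: qk; apply.
rewrite /cusp_pullback /mmap coef_sum big1 // => u _.
rewrite coefCM /mmap1 big_ord_recl big_ord1 /cusp_param /=.
rewrite -!exprM -exprD coefXn.
case: eqP => [ek | _]; last by rewrite mulr0.
by case: nex; do 2!eexists; rewrite mulnC [X in (_ + X)%N]mulnC; exact/esym/ek.
Qed.

End Parametrisation.

(** If both i and j were positive, the left-hand side would exceed l1 + l2.  If
    i = 0, then l1 divides a l2, hence a, hence a = 0; what remains is
    2 j l1 = l1, which is impossible.  The case j = 0 is symmetric. *)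
Lemma half_exponent_gap (l1 l2 a b i j : nat) :
  (1 < l1)%N -> (1 < l2)%N -> coprime l1 l2 ->
  (a <= 1)%N -> (b <= 1)%N -> (0 < a + b)%N ->
  (i * l2 + j * l1 + (i * l2 + j * l1) <> a * l2 + b * l1)%N.
Proof.
move=> h1 h2 cop ha hb hab e.
have /orP[/eqP i0 | /eqP j0] : (i == 0)%N || (j == 0)%N by nia.
- have l1a : (l1 %| a)%N.
    rewrite -(@Gauss_dvdl _ _ l2) // -(@dvdn_addl (b * l1)) ?dvdn_mull // -e i0.
    by rewrite mul0n add0n dvdn_add ?dvdn_mull.
  have a0 : a = 0%N by case: a ha l1a {hab e} => [|[|]] //; rewrite dvdn1 gtn_eqF.
  have b1 : b = 1%N by move: hab; rewrite a0; lia.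
  by move: e; rewrite i0 a0 b1; case: j => [|j]; nia.
- have l2b : (l2 %| b)%N.
    rewrite -(@Gauss_dvdl _ _ l1) 1?coprime_sym //.
    rewrite -(@dvdn_addr (a * l2)) ?dvdn_mull // -e j0.
    by rewrite mul0n addn0 dvdn_add ?dvdn_mull.
  have b0 : b = 0%N by case: b hb l2b {hab e} => [|[|]] //; rewrite dvdn1 gtn_eqF.
  have a1 : a = 1%N by move: hab; rewrite b0; lia.
  by move: e; rewrite j0 b0 a1; case: i => [|i]; nia.
Qed.

Lemma coprime_odd (l1 l2 : nat) : coprime l1 l2 -> odd l1 || odd l2.
Proof.
move=> cop; rewrite -[_ || _]negbK negb_or; apply/negP => /andP[e1 e2].
by have := dvdn_gcd 2 l1 l2; rewrite (eqP cop) !dvdn2 e1 e2.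
Qed.

(** Reading the parities as exponents treats the three cases at once. *)
Lemma parity_polyE (R : realType) (l1 l2 : nat) : coprime l1 l2 ->
  parity_poly R l1 l2 = 'X_0 ^+ odd l1 * 'X_1 ^+ odd l2.
Proof.
move=> /coprime_odd; rewrite /parity_poly.
by case: (odd l1); case: (odd l2); rewrite //= ?expr1 ?expr0 ?mul1r ?mulr1.
Qed.

(** Working with an identity in R[x,y] instead of a class in the quotient serves
    both the quadratic modules and the coordinate ring. *)
Lemma parity_poly_not_sos_mod (R : realType) (l1 l2 : nat)
    (s : seq {mpoly R[2]}) (h : {mpoly R[2]}) :
  (1 < l1)%N -> (1 < l2)%N -> coprime l1 l2 ->
  parity_poly R l1 l2 <> \sum_(q <- s) q ^+ 2 + h * curve_poly R l1 l2.
Proof.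
move=> h1 h2 cop /(congr1 (@cusp_pullback R l1 l2)).
rewrite parity_polyE // rmorphD !rmorphM !rmorphXn /= cusp_pullback_curve mulr0.
rewrite addr0 cusp_pullback_X0 cusp_pullback_X1 -!exprM -exprD => e.
set d := (l2 * odd l1 + l1 * odd l2)%N in e.
(* If l1 and l2 are both odd then d = l1 + l2; otherwise d is the even one. *)
have dd : d = (d./2 + d./2)%N.
  rewrite addnn even_halfK // /d oddD !oddM.
  by case: (odd l1); case: (odd l2).
have : \sum_(g <- map (@cusp_pullback R l1 l2) s) g ^+ 2 = 'X^(d./2 + d./2).
  rewrite -dd e rmorph_sum big_map; apply: eq_bigr => q _.
  by rewrite -rmorphXn.
move=> /sum_sqr_eq_monomial[_ /mapP[q _ ->]] /cusp_pullback_supp[i [j ij]].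
apply: (@half_exponent_gap l1 l2 (odd l1) (odd l2) i j) => //.
- exact: leq_b1.
- exact: leq_b1.
- by have := coprime_odd cop; case: (odd l1); case: (odd l2).
- by rewrite ij -dd /d; congr (_ + _)%N; rewrite mulnC.
Qed.

Lemma parity_poly_ge0 (R : realType) (l1 l2 : nat) (v : 'I_2 -> R) :
  coprime l1 l2 ->
  zero_locus (curve_poly R l1 l2) v -> 0 <= (parity_poly R l1 l2).@[v].
Proof.
move=> /coprime_odd cop.
rewrite /zero_locus /= mevalB !rmorphXn /= !mevalXU => /eqP.
rewrite subr_eq0 => /eqP e.
rewrite /parity_poly; case o1 : (odd l1); case o2 : (odd l2) => /=.
(* (x y)^l1 = y^(l1 + l2) on the curve, and l1 + l2 is even. *)
- rewrite mevalM !mevalXU -(exprn_odd_ge0 _ o1) exprMn e -exprD.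
  by rewrite exprn_even_ge0 // oddD o1 o2.
- by rewrite mevalXU -(exprn_odd_ge0 _ o1) e exprn_even_ge0 ?o2.
- by rewrite mevalXU -(exprn_odd_ge0 _ o2) -e exprn_even_ge0 ?o1.
- by move: cop; rewrite o1 o2.
Qed.

Theorem corollary3p3 (R : realType) (l1 l2 : nat)
    (hl1 : (1 < l1)%N) (hl2 : (1 < l2)%N) (hgcd : gcdn l1 l2 = 1%N) :
  let p := curve_poly R l1 l2 in
  let f := parity_poly R l1 l2 in
  let not_in_modules :=
    forall n : nat, (0 < n)%N -> ~ trunc_quad_module [:: 1; p; - p] n f in
  let not_sos_mod_p :=
    ~ sum_of_squares
        (\pi_(coordinate_ring (curve_poly_nonunit R hl1 hl2)) f) in
  [/\ forall v, zero_locus p v -> 0 <= f.@[v],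
      not_in_modules
    & not_in_modules <-> not_sos_mod_p].
Proof.
move=> p f not_in_modules not_sos_mod_p.
have cop : coprime l1 l2 by apply/eqP.
(* The generators p and -p contribute multiples of p. *)
have nmod : not_in_modules.
  move=> n _ [F [_ ef]].
  move: ef; rewrite !big_ord_recl big_ord0 /= addr0.
  set F1 := F (lift _ _); set F2 := F (lift _ (lift _ _)) => ef.
  apply: (@parity_poly_not_sos_mod R l1 l2 (F ord0)
    (\sum_(q <- F1) q ^+ 2 - \sum_(q <- F2) q ^+ 2)) => //.
  rewrite -/f -/p ef mulrBl !mulr_suml -sumrN; congr (_ + (_ + _)).
  - by apply: eq_bigr => q _; rewrite mul1r.
  - by apply: eq_bigr => q _; rewrite mulrC.
  - by apply: eq_bigr => q _; rewrite mulNr mulrC.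
(* Representatives of the classes give an identity up to a multiple of p. *)
have nsos : not_sos_mod_p.
  move=> [s es].
  have : f = \sum_(q <- map repr s) q ^+ 2
    %[mod coordinate_ring (curve_poly_nonunit R hl1 hl2)].
    rewrite es rmorph_sum big_map; apply: eq_bigr => b _.
    by rewrite rmorphXn /= reprK.
  move=> /eqP; rewrite -Quotient.idealrBE => /principal_idealP[h eh].
  apply: (@parity_poly_not_sos_mod R l1 l2 (map repr s) h) => //.
  by rewrite -eh addrC subrK.
by split=> // v; apply: parity_poly_ge0.
Qed.
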